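(* Every set \(\Gamma\) of atomic sentences over a signature \(\Delta = (\Sigma^{n}, \Sigma^{r} \subseteq \Sigma)\) of hybrid-dynamic first-order logic with user-defined sharing admits a reachable initial model \((W^{\Gamma}, M^{\Gamma})\), i.e. a reachable \(\Delta\)-model satisfying \(\Gamma\) with exactly one \(\Delta\)-homomorphism into every \(\Delta\)-model satisfying \(\Gamma\).
   Context: Signatures: \(\Delta = (\Sigma^{n}, \Sigma^{r} \subseteq \Sigma)\), where \(\Sigma^{n} = (\{\star\}, F^{n}, P^{n})\) is a one-sorted first-order signature of nominals and \(\Sigma^{r} = (S^{r},F^{r},P^{r}) \subseteq \Sigma = (S,F,P)\) are many-sorted first-order signatures; symbols in \(\Sigma^{r}\) are rigid, the others (\(F^{f}, P^{f}\)) flexible. A \(\Delta\)-model is \((W,M)\) with \(W\) a \(\Sigma^{n}\)-model, \(|W|\) the carrier of \(\star\) (worlds), and \(M=\{M_w\}_{w\in|W|}\) \(\Sigma\)-models interpreting all rigid symbols identically. A \(\Delta\)-homomorphism \((W,M)\to(W',M')\) is a \(\Sigma^{n}\)-homomorphism \(h\colon W\to W'\) with \(\Sigma\)-homomorphisms \(h_w\colon M_w\to M'_{h(w)}\) coinciding on rigid sorts. Hybrid terms: the standard hybrid-term family \(\{T^{\Delta}_k\}_{k}\), indexed by ground nominal terms \(k \in T_{\Sigma^n}\), is the least family of \(S\)-sorted sets with \(\sigma(t)\in T^{\Delta}_{k,s}\) for rigid \(\sigma\in F^{r}_{ar\to s}\), \(\sigma(k,t)\in T^{\Delta}_{k,s}\)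 for flexible \(\sigma\in F^{f}_{ar\to s}\) (\(t\in T^{\Delta}_{k,ar}\)), and \(T^{\Delta}_{k_0,s} \subseteq T^{\Delta}_{k,s}\) for rigid sorts \(s\). In a \(\Delta\)-model \((W,M)\), \(W_k\) is the value of \(k\) and \((W,M)_t \in M_{W_k}\) the value of \(t \in T^{\Delta}_k\) (rigid \(\sigma\) evaluated by \(M_{W_k,\sigma}\), flexible \(\sigma(k',\cdot)\) by \(M_{W_{k'},\sigma}\)); equivalently via the unique homomorphism from the standard hybrid-term model. A \(\Delta\)-model is reachable if every world is some \(W_k\) and every element of every \(M_{W_k}\) is some \((W,M)_t\) with \(t \in T^{\Delta}_k\). Atomic sentences and their satisfaction (independent of the world of evaluation): nominal equation \(k_1 = k_2\): \(W_{k_1} = W_{k_2}\); nominal relation \(\lambda(k)\) (\(\lambda \in P^{n}\)): \(W_k \in W_\lambda\); hybrid equation \(t_1 =_{k} t_2\) (\(t_i \in T^{\Delta}_{k,s}\)): \((W,M)_{t_1} = (W,M)_{t_2}\); rigid relation \(\varpi(t)\) (\(\varpi \in P^{r}_{ar}\), \(t \in T^{\Delta}_{k,ar}\)): \((W,M)_t \in M_{w,\varpi}\) (the same for all \(w\)); flexible relation \(\pi(k,t)\) (\(\pi \in P^{f}_{ar}\), \(t \in T^{\Delta}_{k,ar}\)): \((W,M)_t \in M_{W_k,\pi}\). A model satisfies a set of sentences iff it satisfies each at every world. *)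

(* Defs.v *)
From mathcomp Require Import all_boot.
From Stdlib Require Import JMeq.

Set Implicit Arguments.
Unset Strict Implicit.
Unset Printing Implicit Defensive.

(** * Many-sorted first-order logic *)

Record fosig (S : Type) := FOSig {
  fsym : seq S -> S -> Type;
  psym : seq S -> Type
}.

(** [tuples A ar] is the product of the [A s], [s] ranging over the entries of
    [ar]; it is a function type so that the inductive families of terms below
    can take tuples of terms as arguments. *)
Definition tuples (S : Type) (A : S -> Type) (ar : seq S) : Type :=
  forall i : 'I_(size ar), A (tnth (in_tuple ar) i).

(** Carriers may be empty: initial models require it. *)
Record model (S : Type) (Sg : fosig S) := Model {
  carrier :> S -> Type;
  fn_int : forall (ar : seq S) (s : S), fsym Sg ar s -> tuples carrier ar -> carrier s;
  rel_int : forall ar : seq S, psym Sg ar -> tuples carrier ar -> Prop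
}.

Record hom (S : Type) (Sg : fosig S) (A B : model Sg) := Hom {
  hom_fun :> forall s : S, A s -> B s;
  hom_fn : forall (ar : seq S) (s : S) (f : fsym Sg ar s) (x : tuples A ar),
    hom_fun (fn_int f x) = fn_int f (fun i => hom_fun (x i));
  hom_rel : forall (ar : seq S) (p : psym Sg ar) (x : tuples A ar),
    rel_int p x -> rel_int p (fun i => hom_fun (x i))
}.

Inductive gterm (S : Type) (Sg : fosig S) : S -> Type :=
| GApp (ar : seq S) (s : S) (f : fsym Sg ar s) :
    (forall i : 'I_(size ar), gterm Sg (tnth (in_tuple ar) i)) -> gterm Sg s.

Fixpoint gval (S : Type) (Sg : fosig S) (A : model Sg) (s : S)
    (t : gterm Sg s) : A s :=
  match t with
  | GApp _ _ f ts => fn_int f (fun i => gval A (ts i))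
  end.

(** A subsignature selects sorts and symbols; the last two fields say that the
    selected symbols only involve selected sorts. *)
Record subsig (S : Type) (Sg : fosig S) := SubSig {
  sub_sort : S -> Prop;
  sub_fn : forall (ar : seq S) (s : S), fsym Sg ar s -> Prop;
  sub_rel : forall ar : seq S, psym Sg ar -> Prop;
  sub_fn_sort : forall (ar : seq S) (s : S) (f : fsym Sg ar s), sub_fn f ->
    (forall i : 'I_(size ar), sub_sort (tnth (in_tuple ar) i)) /\ sub_sort s;
  sub_rel_sort : forall (ar : seq S) (p : psym Sg ar), sub_rel p ->
    forall i : 'I_(size ar), sub_sort (tnth (in_tuple ar) i)
}.

(** * Hybrid-dynamic first-order logic with user-defined sharing *)

Record signature := Signature {
  nom : fosig unit;
  sorts : Type;
  base : fosig sorts;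
  rigid : subsig base
}.

Definition rigid_sort (D : signature) : sorts D -> Prop := sub_sort (rigid D).
Definition rigid_fn (D : signature) (ar : seq (sorts D)) (s : sorts D)
  (f : fsym (base D) ar s) : Prop := sub_fn (rigid D) f.
Definition rigid_rel (D : signature) (ar : seq (sorts D))
  (p : psym (base D) ar) : Prop := sub_rel (rigid D) p.

Definition nterm (D : signature) : Type := gterm (nom D) tt.

(** Sharing is literal equality of the interpretations of rigid symbols at any
    two worlds.  As [share_sort] only makes the types of these interpretations
    propositionally equal, the equality of functions and of relations is
    heterogeneous. *)
Record dmodel (D : signature) := DModel {
  worlds : model (nom D);
  at_world :> worlds tt -> model (base D);
  share_sort : forall s : sorts D, rigid_sort s ->
    forall w w' : worlds tt, at_world w s = at_world w' s;
  share_fn : forall (ar : seq (sorts D)) (s : sorts D) (f : fsym (base D) ar s),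
    rigid_fn f -> forall w w' : worlds tt,
    JMeq (@fn_int _ _ (at_world w) ar s f) (@fn_int _ _ (at_world w') ar s f);
  share_rel : forall (ar : seq (sorts D)) (p : psym (base D) ar),
    rigid_rel p -> forall w w' : worlds tt,
    JMeq (@rel_int _ _ (at_world w) ar p) (@rel_int _ _ (at_world w') ar p)
}.

Record dhom (D : signature) (M N : dmodel D) := DHom {
  dhom_nom : hom (worlds M) (worlds N);
  dhom_at : forall w : worlds M tt, hom (M w) (N (dhom_nom tt w));
  dhom_share : forall s : sorts D, rigid_sort s -> forall w w' : worlds M tt,
    JMeq (hom_fun (dhom_at w) (s := s)) (hom_fun (dhom_at w') (s := s))
}.

(** [HIncl] renders the inclusion of the terms at [k0] of a rigid sort among
    those at [k]; it is evaluated as the identity, see [hval]. *)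
Inductive hterm (D : signature) : nterm D -> sorts D -> Type :=
| HRigid (k : nterm D) (ar : seq (sorts D)) (s : sorts D)
    (f : fsym (base D) ar s) : rigid_fn f ->
    (forall i : 'I_(size ar), hterm k (tnth (in_tuple ar) i)) -> hterm k s
| HFlex (k : nterm D) (ar : seq (sorts D)) (s : sorts D)
    (f : fsym (base D) ar s) : ~ rigid_fn f ->
    (forall i : 'I_(size ar), hterm k (tnth (in_tuple ar) i)) -> hterm k s
| HIncl (k0 k : nterm D) (s : sorts D) : rigid_sort s ->
    hterm k0 s -> hterm k s.

Definition cast (A B : Type) (e : A = B) (x : A) : B :=
  match e in _ = C return C with erefl => x end.

Definition nval (D : signature) (M : dmodel D) (k : nterm D) : worlds M tt :=
  gval (worlds M) k.

Fixpoint hval (D : signature) (M : dmodel D) (k : nterm D) (s : sorts D)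
    (t : hterm k s) : M (nval M k) s :=
  match t in hterm k s return M (nval M k) s with
  | HRigid k _ _ f _ ts => @fn_int _ _ (M (nval M k)) _ _ f (fun i => hval M (ts i))
  | HFlex k _ _ f _ ts => @fn_int _ _ (M (nval M k)) _ _ f (fun i => hval M (ts i))
  | HIncl k0 k _ r t0 => cast (share_sort r (nval M k0) (nval M k)) (hval M t0)
  end.

Definition reachable (D : signature) (M : dmodel D) : Prop :=
  (forall w : worlds M tt, exists k : nterm D, nval M k = w) /\
  (forall (k : nterm D) (s : sorts D) (x : M (nval M k) s),
     exists t : hterm k s, hval M t = x).

Inductive sentence (D : signature) : Type :=
| NomEq (k1 k2 : nterm D)
| NomRel (ar : seq unit) (l : psym (nom D) ar) (ks : tuples (gterm (nom D)) ar)
| HybEq (k : nterm D) (s : sorts D) (t1 t2 : hterm k s)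
| RigidRel (k : nterm D) (ar : seq (sorts D)) (p : psym (base D) ar)
    (r : rigid_rel p) (ts : tuples (hterm k) ar)
| FlexRel (k : nterm D) (ar : seq (sorts D)) (p : psym (base D) ar)
    (r : ~ rigid_rel p) (ts : tuples (hterm k) ar).

(** The world [w] of evaluation is irrelevant for atomic sentences; rigid
    relations, which are the same at all worlds, are read at the world named by
    [k], where the values of their arguments live. *)
Definition sat_at (D : signature) (M : dmodel D) (w : worlds M tt)
    (phi : sentence D) : Prop :=
  match phi with
  | NomEq k1 k2 => nval M k1 = nval M k2
  | NomRel _ l ks => rel_int l (fun i => gval (worlds M) (ks i))
  | HybEq _ _ t1 t2 => hval M t1 = hval M t2
  | RigidRel k _ p _ ts => @rel_int _ _ (M (nval M k)) _ p (fun i => hval M (ts i))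
  | FlexRel k _ p _ ts => @rel_int _ _ (M (nval M k)) _ p (fun i => hval M (ts i))
  end.

Definition satisfies (D : signature) (M : dmodel D)
    (Gamma : sentence D -> Prop) : Prop :=
  forall phi : sentence D, Gamma phi -> forall w : worlds M tt, sat_at w phi.

(* Main.v *)
From mathcomp Require Import all_boot.
From Stdlib Require Import JMeq ClassicalEpsilon.
From Stdlib Require Import FunctionalExtensionality PropExtensionality ProofIrrelevance.
Require Import Defs.

Set Implicit Arguments.
Unset Strict Implicit.
Unset Printing Implicit Defensive.

(** Two terms are identified when they have the same value in every model of
    [Gamma], and an atom holds of the resulting classes when it holds in every
    model of [Gamma]; values of hybrid terms living at different worlds are
    compared heterogeneously.  A carrier of the quotient at a world [w] consists
    of the classes of the terms at names of [w], or at arbitrary nominals for a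
    rigid sort, so that rigid carriers do not depend on [w].  The quotient is
    reachable, which gives uniqueness, and evaluating representatives gives the
    homomorphism into any model of [Gamma]. *)

(** * Heterogeneous equality of functions and applications *)

Lemma castE (A B : Type) (e : A = B) (x : A) : JMeq (cast e x) x.
Proof. by case: B / e. Qed.

(** [JMeq] of functions does not determine their domains and codomains, so the equalities of types
    are separate hypotheses; eliminating these turns [JMeq] into ordinary equality. *)
Lemma JMeq_app (I : Type) (X X' : I -> Type) (Y Y' : Type)
    (f : (forall i, X i) -> Y) (f' : (forall i, X' i) -> Y') x x' :
  (forall i, X i = X' i) -> Y = Y' -> JMeq f f' ->
  (forall i, JMeq (x i) (x' i)) -> JMeq (f x) (f' x').
Proof.
move=> /functional_extensionality eX eY.
case: X' / eX f' x' => f' x'; case: Y' / eY f' => f' eff' exx'.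
rewrite (JMeq_eq eff').
suff -> : x = x' by [].
by apply: functional_extensionality_dep => i; apply: JMeq_eq.
Qed.

Lemma JMeq_funext (I : Type) (X X' : I -> Type) (Y Y' : Type)
    (f : (forall i, X i) -> Y) (f' : (forall i, X' i) -> Y') :
  (forall i, X i = X' i) -> Y = Y' ->
  (forall x x', (forall i, JMeq (x i) (x' i)) -> JMeq (f x) (f' x')) ->
  JMeq f f'.
Proof.
move=> /functional_extensionality eX eY.
case: X' / eX f' => f'; case: Y' / eY f' => f' eff'.
suff -> : f = f' by [].
by apply: functional_extensionality => x; apply: JMeq_eq; apply: eff'.
Qed.

Lemma JMeq_app1 (X X' Y Y' : Type) (f : X -> Y) (f' : X' -> Y') x x' :
  X = X' -> Y = Y' -> JMeq f f' -> JMeq x x' -> JMeq (f x) (f' x').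
Proof.
move=> eX eY.
case: X' / eX f' x' => f' x'; case: Y' / eY f' => f' eff' exx'.
by rewrite (JMeq_eq eff') (JMeq_eq exx').
Qed.

Lemma JMeq_funext1 (X X' Y Y' : Type) (f : X -> Y) (f' : X' -> Y') :
  X = X' -> Y = Y' -> (forall x x', JMeq x x' -> JMeq (f x) (f' x')) ->
  JMeq f f'.
Proof.
move=> eX eY; case: X' / eX f' => f'; case: Y' / eY f' => f' eff'.
suff -> : f = f' by [].
by apply: functional_extensionality => x; apply: JMeq_eq; apply: eff'.
Qed.

(** * Quotients with restricted representatives *)

Section Quotient.
Variables (A : Type) (R : A -> A -> Prop).
Hypothesis Rxx : forall a, R a a.
Hypothesis Rsym : forall a b, R a b -> R b a.
Hypothesis Rtrans : forall a b c, R a b -> R b c -> R a c.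

(** A class is a predicate on all of [A], and [Q] only restricts which classes occur. Classes for
    different [Q] are thus comparable through [sval], and equal [Q] give equal types, as literal
    sharing of carriers demands. *)
Definition quot (Q : A -> Prop) : Type :=
  {P : A -> Prop | exists2 a, Q a & P = R a}.

Definition class (Q : A -> Prop) (a : A) (Qa : Q a) : quot Q :=
  exist _ (R a) (ex_intro2 _ _ a Qa erefl).

Lemma classE a b : R a = R b <-> R a b.
Proof.
split=> [-> // | Rab]; apply: functional_extensionality => c.
apply: propositional_extensionality; split=> [Rac | Rbc].
  exact: Rtrans (Rsym Rab) Rac.
exact: Rtrans Rab Rbc.
Qed.

Lemma quot_inj Q (x y : quot Q) : sval x = sval y -> x = y.
Proof.
case: x y => [P p] [P' p'] /= eP; case: P' / eP p' => p'.
by rewrite (proof_irrelevance _ p p').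
Qed.

Lemma quot_rep Q (x : quot Q) : exists2 a, Q a & sval x = R a.
Proof. by case: x. Qed.

Lemma JMeq_sval Q Q' (x : quot Q) (y : quot Q') :
  Q = Q' -> JMeq x y -> sval x = sval y.
Proof. by move=> eQ; case: Q' / eQ y => y exy; rewrite (JMeq_eq exy). Qed.

Lemma sval_JMeq Q Q' (x : quot Q) (y : quot Q') :
  Q = Q' -> sval x = sval y -> JMeq x y.
Proof. by move=> eQ; case: Q' / eQ y => y /quot_inj ->. Qed.

End Quotient.

(** * Extensionality of homomorphisms *)

Lemma hom_ext (S : Type) (Sg : fosig S) (A B : model Sg) (h h' : hom A B) :
  (forall s x, h s x = h' s x) -> h = h'.
Proof.
case: h h' => [h hf hr] [h' hf' hr'] /= ehh'.
have e : h = h'.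
  apply: functional_extensionality_dep => s.
  exact: functional_extensionality.
case: h' / e hf' hr' {ehh'} => hf' hr'.
by rewrite (proof_irrelevance _ hf hf') (proof_irrelevance _ hr hr').
Qed.

Lemma hom_gval (S : Type) (Sg : fosig S) (A B : model Sg) (h : hom A B) s
  (t : gterm Sg s) : h s (gval A t) = gval B t.
Proof.
elim: t => ar {}s f ts IH /=; rewrite hom_fn; congr fn_int.
exact: functional_extensionality_dep.
Qed.

(** The second hypothesis is heterogeneous because the target of [dhom_at h w] depends on
    [dhom_nom h]. *)
Lemma dhom_ext (D : signature) (M N : dmodel D) (h h' : dhom M N) :
  (forall u w, dhom_nom h u w = dhom_nom h' u w) ->
  (forall w s x, JMeq (dhom_at h w s x) (dhom_at h' w s x)) -> h = h'.
Proof.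
case: h h' => [n a sh] [n' a' sh'] /= /hom_ext en.
case: n' / en a' sh' => a' sh' eaa'.
have e : a = a'.
  apply: functional_extensionality_dep => w; apply: hom_ext => s x.
  exact: JMeq_eq.
by case: a' / e sh' {eaa'} => sh'; rewrite (proof_irrelevance _ sh sh').
Qed.

(** * Values under sharing of rigid symbols *)

Section Values.
Variables (D : signature) (N : dmodel D).

Lemma fn_int_JMeq ar s (f : fsym (base D) ar s) (w w' : worlds N tt)
    (x : tuples (N w) ar) (x' : tuples (N w') ar) :
  w = w' \/ rigid_fn f -> (forall i, JMeq (x i) (x' i)) ->
  JMeq (fn_int f x) (fn_int f x').
Proof.
case=> [ew | rf].
  case: w' / ew x' => x' exx'.
  exact: (JMeq_app (f := fn_int f) (f' := fn_int f)).
have [rar rs] := sub_fn_sort rf.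
apply: (JMeq_app (f := fn_int f) (f' := fn_int f)).
- by move=> i; apply: share_sort; apply: rar.
- exact: share_sort.
- exact: share_fn.
Qed.

Lemma rel_int_share ar (p : psym (base D) ar) (w w' : worlds N tt)
    (x : tuples (N w) ar) (x' : tuples (N w') ar) :
  w = w' \/ rigid_rel p -> (forall i, JMeq (x i) (x' i)) ->
  rel_int p x = rel_int p x'.
Proof.
move=> h exx'; apply: JMeq_eq; move: h exx'; case=> [ew | rp].
  case: w' / ew x' => x' exx'.
  exact: (JMeq_app (f := rel_int p) (f' := rel_int p)).
apply: (JMeq_app (f := rel_int p) (f' := rel_int p)) => //.
  by move=> i; apply: share_sort; apply: (sub_rel_sort rp).
exact: share_rel.
Qed.

(** Rigidity is decided classically, so that one formula interprets rigid and flexible symbols in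
    the quotient. *)
Definition happ (k : nterm D) ar s (f : fsym (base D) ar s)
    (ts : tuples (hterm k) ar) : hterm k s :=
  match excluded_middle_informative (rigid_fn f) with
  | left r => HRigid r ts
  | right r => HFlex r ts
  end.

Lemma hval_happ k ar s (f : fsym (base D) ar s) (ts : tuples (hterm k) ar) :
  hval N (happ f ts) = fn_int f (fun i => hval N (ts i)).
Proof. by rewrite /happ; case: excluded_middle_informative. Qed.

End Values.

(** * Preservation of values, and uniqueness of homomorphisms *)

Lemma hom_hval (D : signature) (M N : dmodel D) (h : dhom M N) k s
    (t : hterm k s) : JMeq (dhom_at h (nval M k) s (hval M t)) (hval N t).
Proof.
have en k' : dhom_nom h tt (nval M k') = nval N k' by apply: hom_gval.
elim: t => [{}k ar {}s f rf ts IH|{}k ar {}s f rf ts IH|k0 {}k {}s rs t IH] /=.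
- by rewrite hom_fn; apply: fn_int_JMeq => //; left.
- by rewrite hom_fn; apply: fn_int_JMeq => //; left.
(* The casts vanish up to [JMeq], and [dhom_share] identifies the components of [h] at the worlds
   named by [k0] and [k]. *)
- apply: JMeq_trans (JMeq_sym (castE _ _)).
  apply: JMeq_trans IH; apply: JMeq_app1 (castE _ _); last exact: dhom_share.
    exact: share_sort.
  exact: share_sort.
Qed.

(** Worlds and elements of [M] are values of terms, and every homomorphism sends these to the values
    in [N]. *)
Lemma reachable_hom_unique (D : signature) (M N : dmodel D) (h h' : dhom M N) :
  reachable M -> h = h'.
Proof.
move=> [reachW reachM]; apply: dhom_ext => [[] w | w s x].
  by have [k <-] := reachW w; rewrite !hom_gval.
have [k ew] := reachW w; case: w / ew x => x.
have [t <-] := reachM k s x.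
exact: JMeq_trans (hom_hval h t) (JMeq_sym (hom_hval h' t)).
Qed.

(** * Worlds of the quotient *)

Section InitialModel.
Variables (D : signature) (Gamma : sentence D -> Prop).

(** As [Prop] is impredicative, quantifying over all models does not raise the universe of the
    quotient, which can itself carry such a model. *)
Definition neqv u (k k' : gterm (nom D) u) : Prop :=
  forall N : dmodel D, satisfies N Gamma ->
  gval (worlds N) k = gval (worlds N) k'.

Lemma neqv_class u (k k' : gterm (nom D) u) : neqv k = neqv k' <-> neqv k k'.
Proof.
apply: classE => // [a b ab | a b c ab bc] N sN; first by rewrite ab.
by rewrite ab // bc.
Qed.

Definition world u : Type := quot (@neqv u) (fun _ => True).

Definition wclass u (k : gterm (nom D) u) : world u :=
  @class _ (@neqv u) (fun _ => True) k I.

Lemma wrep_ex u (w : world u) : exists k, wclass k = w.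
Proof. by have [k _ e] := quot_rep w; exists k; apply: quot_inj. Qed.

Definition wrep u (w : world u) : gterm (nom D) u :=
  sval (constructive_indefinite_description _ (wrep_ex w)).

Lemma wrepK u (w : world u) : wclass (wrep w) = w.
Proof. exact: svalP (constructive_indefinite_description _ (wrep_ex w)). Qed.

Lemma wclass_eq u (k k' : gterm (nom D) u) :
  wclass k = wclass k' <-> neqv k k'.
Proof.
split=> [/(congr1 sval) | /neqv_class e]; first by move/neqv_class.
exact: quot_inj.
Qed.

Lemma wclassK u (k : gterm (nom D) u) : neqv (wrep (wclass k)) k.
Proof. by apply/wclass_eq; apply: wrepK. Qed.

Definition init_worlds : model (nom D) := @Model _ (nom D) world
  (fun ar s f x => wclass (GApp f (fun i => wrep (x i))))
  (fun ar p x => forall N : dmodel D, satisfies N Gamma ->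
     rel_int (m := worlds N) p (fun i => gval (worlds N) (wrep (x i)))).

Lemma gval_init u (k : gterm (nom D) u) : gval init_worlds k = wclass k.
Proof.
elim: k => ar s f ts IH /=; apply/wclass_eq => N sN /=; congr fn_int.
by apply: functional_extensionality_dep => i; rewrite IH; apply: wclassK.
Qed.

(** * Classes of hybrid terms and the carriers at each world *)

Definition heqv s (a b : {k : nterm D & hterm k s}) : Prop :=
  forall N : dmodel D, satisfies N Gamma ->
  JMeq (hval N (projT2 a)) (hval N (projT2 b)).

Notation "[ 'ht' t ]" := (existT (fun k => hterm k _) _ t) (format "[ 'ht'  t ]").

Lemma heqv_class s (a b : {k : nterm D & hterm k s}) :
  heqv a = heqv b <-> heqv a b.
Proof.
apply: classE => // {a b} [a b ab | a b c ab bc] N sN.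
  exact: JMeq_sym (ab N sN).
exact: JMeq_trans (ab N sN) (bc N sN).
Qed.

Definition named (w : world tt) s (a : {k : nterm D & hterm k s}) : Prop :=
  rigid_sort s \/ wclass (projT1 a) = w.

Definition elt (w : world tt) s : Type := quot (@heqv s) (@named w s).

Lemma named_share s (w w' : world tt) :
  rigid_sort s -> @named w s = @named w' s.
Proof.
move=> rs; apply: functional_extensionality => a.
by apply: propositional_extensionality; split=> _; left.
Qed.

(** Rigid symbols are shared between the two worlds; flexible ones agree because [k] and [k'] name
    the same world in every model of [Gamma]; an inclusion is simply redirected to [k']. *)
Lemma rename_term k k' s (t : hterm k s) :
  neqv k k' -> exists t' : hterm k' s, heqv [ht t] [ht t'].
Proof.
elim: t => [{}k ar {}s f rf ts IH|{}k ar {}s f rf ts IH|k0 {}k {}s rs t _] kk'.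
- pose c i := constructive_indefinite_description _ (IH i kk').
  exists (happ f (fun i => sval (c i))) => N sN; rewrite /= hval_happ.
  apply: fn_int_JMeq => [|i]; first by right.
  exact: (svalP (c i) N sN).
- pose c i := constructive_indefinite_description _ (IH i kk').
  exists (happ f (fun i => sval (c i))) => N sN; rewrite /= hval_happ.
  apply: fn_int_JMeq => [|i]; first by left; exact: (kk' N sN).
  exact: (svalP (c i) N sN).
- exists (HIncl k' rs t) => N sN /=.
  exact: JMeq_trans (castE _ _) (JMeq_sym (castE _ _)).
Qed.

Lemma elt_term k s (x : elt (wclass k) s) :
  exists t : hterm k s, heqv [ht t] = sval x.
Proof.
have [[k0 t] [rs | /wclass_eq /= k0k] ->] := quot_rep x.
  exists (HIncl k rs t); apply/heqv_class => N sN.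
  exact: castE.
have [t' tt'] := rename_term t k0k.
by exists t'; apply/esym/heqv_class.
Qed.

Lemma hrep_ex (w : world tt) s (x : elt w s) :
  exists t : hterm (wrep w) s, heqv [ht t] = sval x.
Proof.
(* [x] is still quantified here, so that rewriting the world also changes its type. *)
by have := @elt_term (wrep w) s; rewrite wrepK; apply.
Qed.

Definition hrep (w : world tt) s (x : elt w s) : hterm (wrep w) s :=
  sval (constructive_indefinite_description _ (hrep_ex x)).

Lemma hrepK (w : world tt) s (x : elt w s) : heqv [ht hrep x] = sval x.
Proof. exact: svalP (constructive_indefinite_description _ (hrep_ex x)). Qed.

Lemma hrep_heqv (w : world tt) k s (x : elt w s) (t : hterm k s) :
  sval x = heqv [ht t] -> heqv [ht hrep x] [ht t].
Proof. by move=> e; apply/heqv_class; rewrite hrepK. Qed.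

(** The representatives may be terms at different nominals, but in both cases the carriers have the
    same [named] predicate, so [x] and [x'] are the same class. *)
Lemma hrep_JMeq (w w' : world tt) s (x : elt w s) (x' : elt w' s) :
  w = w' \/ rigid_sort s -> JMeq x x' -> heqv [ht hrep x] [ht hrep x'].
Proof.
move=> ww' xx'; apply/heqv_class; rewrite !hrepK; apply: JMeq_sval xx'.
by case: ww' => [-> // | rs]; apply: named_share.
Qed.

Definition hclass (w : world tt) s (t : hterm (wrep w) s) : elt w s :=
  @class _ (@heqv s) (@named w s) [ht t] (or_intror (wrepK w)).

(** * The quotient as a model with sharing *)

Definition init_at (w : world tt) : model (base D) := @Model _ (base D) (elt w)
  (fun ar s f x => hclass (happ f (fun i => hrep (x i))))
  (fun ar p x => forall N : dmodel D, satisfies N Gamma ->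
     rel_int (m := N (nval N (wrep w))) p (fun i => hval N (hrep (x i)))).

Lemma init_share_sort s : rigid_sort s ->
  forall w w' : world tt, init_at w s = init_at w' s.
Proof. by move=> rs w w'; rewrite /= /elt (named_share w w' rs). Qed.

Lemma init_share_fn ar s (f : fsym (base D) ar s) : rigid_fn f ->
  forall w w' : world tt,
  JMeq (@fn_int _ _ (init_at w) ar s f) (@fn_int _ _ (init_at w') ar s f).
Proof.
move=> rf w w'; have [rar rs] := sub_fn_sort rf.
apply: JMeq_funext => [i | | x x' xx'].
- exact/init_share_sort/rar.
- exact: init_share_sort.
apply: sval_JMeq; first exact: named_share.
apply/heqv_class => N sN; rewrite /= !hval_happ.
apply: fn_int_JMeq => [|i]; first by right.
exact: (hrep_JMeq (or_intror (rar i)) (xx' i) sN).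
Qed.

Lemma init_share_rel ar (p : psym (base D) ar) : rigid_rel p ->
  forall w w' : world tt,
  JMeq (@rel_int _ _ (init_at w) ar p) (@rel_int _ _ (init_at w') ar p).
Proof.
move=> rp w w'; have rar := sub_rel_sort rp.
apply: JMeq_funext => [i | // | x x' xx'].
  exact/init_share_sort/rar.
have xx'_val N (sN : satisfies N Gamma) i :
    JMeq (hval N (hrep (x i))) (hval N (hrep (x' i))).
  exact: (hrep_JMeq (or_intror (rar i)) (xx' i) sN).
suff -> : rel_int p x = rel_int p x' by [].
apply: propositional_extensionality; split=> h N sN; have := h N sN.
  by rewrite (rel_int_share (or_intror rp) (xx'_val N sN)).
by rewrite -(rel_int_share (or_intror rp) (xx'_val N sN)).
Qed.

Definition init_model : dmodel D := @DModel D init_worlds init_at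
  init_share_sort init_share_fn init_share_rel.

(** * Values in the quotient, reachability and satisfaction *)

Lemma nval_init k : nval init_model k = wclass k.
Proof. exact: gval_init. Qed.

Lemma wrep_nval k : neqv (wrep (nval init_model k)) k.
Proof. by rewrite nval_init; apply: wclassK. Qed.

(** Stated through [sval] because the value lies in the carrier at [nval init_model k], which equals
    [wclass k] only propositionally. *)
Lemma sval_hval_init k s (t : hterm k s) :
  sval (hval init_model t : elt _ s) = heqv [ht t].
Proof.
elim: t => [{}k ar {}s f rf ts IH|{}k ar {}s f rf ts IH|k0 {}k {}s rs t IH].
- apply/heqv_class => N sN; rewrite /= hval_happ.
  (* The class was formed at the chosen name of the world of [k], which is only [neqv] to [k]. *)
  apply: fn_int_JMeq => [|i]; first by left; apply: wrep_nval.
  exact: (hrep_heqv (IH i) sN).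
- apply/heqv_class => N sN; rewrite /= hval_happ.
  apply: fn_int_JMeq => [|i]; first by left; apply: wrep_nval.
  exact: (hrep_heqv (IH i) sN).
- transitivity (heqv [ht t]).
    by rewrite -IH; apply: JMeq_sval (castE _ _); apply: named_share.
  by apply/heqv_class => N sN; apply: JMeq_sym (castE _ _).
Qed.

Lemma init_reachable : reachable init_model.
Proof.
split=> [w | k s x]; first by exists (wrep w); rewrite nval_init wrepK.
have [t e] : exists t : hterm k s, heqv [ht t] = sval (x : elt _ s).
  by move: x; rewrite nval_init => x; apply: elt_term.
by exists t; apply: quot_inj; rewrite sval_hval_init.
Qed.

Lemma rel_init k ar (p : psym (base D) ar) (ts : tuples (hterm k) ar) :
  (forall N : dmodel D, satisfies N Gamma ->
     rel_int (m := N (nval N k)) p (fun i => hval N (ts i))) ->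
  rel_int (m := init_model (nval init_model k)) p
    (fun i => hval init_model (ts i)).
Proof.
move=> h N sN; have := h N sN.
rewrite -(rel_int_share (w := nval N (wrep (nval init_model k)))
  (x := fun i => hval N (hrep (hval init_model (ts i) : elt _ _)))) //.
  by left; apply: wrep_nval.
by move=> i; apply: (hrep_heqv (sval_hval_init (ts i)) sN).
Qed.

(** An atom of [Gamma] holds in all models of [Gamma], which is what its truth for the classes
    amounts to. *)
Lemma init_satisfies : satisfies init_model Gamma.
Proof.
move=> phi Gphi w.
(* A world of [init_model] has a name, so every model of [Gamma] has a world. *)
have sat_phi N (sN : satisfies N Gamma) := sN phi Gphi (nval N (wrep w)).
case: phi Gphi sat_phi => [k1 k2|ar l ks|k s t1 t2|k ar p r ts|k ar p r ts] /= _ h.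
- by rewrite !nval_init; apply/wclass_eq.
- move=> N sN; rewrite (_ : (fun i => _) = fun i => gval (worlds N) (ks i)).
    exact: h.
  apply: functional_extensionality_dep => i.
  by rewrite gval_init; apply: wclassK.
- apply: quot_inj; rewrite !sval_hval_init; apply/heqv_class => N sN /=.
  by rewrite (h N sN).
- exact: rel_init.
- exact: rel_init.
Qed.

(** * The homomorphism into a model of [Gamma] *)

Variables (N : dmodel D) (sN : satisfies N Gamma).

(** Kept transparent: the image of [w] must reduce to the value of [wrep w], the world where the
    values of [hrep x] live. *)
Definition init_hom_nom : hom (worlds init_model) (worlds N).
Proof.
exists (fun u (w : world u) => gval (worlds N) (wrep w)) => [ar s f x | ar p x].
  exact: (wclassK _ sN).
by apply.
Defined.

Definition init_hom_at (w : world tt) :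
  hom (init_model w) (N (init_hom_nom tt w)).
Proof.
exists (fun s (x : elt w s) => hval N (hrep x)) => [ar s f x | ar p x].
  (* Both sides are now values of terms at [wrep w]: the representative of the class of a [happ]
     term, and that term itself. *)
  apply: JMeq_eq; rewrite -hval_happ.
  exact: (@hrep_heqv w _ _ (hclass _) (happ f _) erefl N sN).
by apply.
Defined.

Lemma init_hom_share s : rigid_sort s -> forall w w' : world tt,
  JMeq (hom_fun (init_hom_at w) (s := s)) (hom_fun (init_hom_at w') (s := s)).
Proof.
move=> rs w w'; apply: JMeq_funext1 => [||x x' xx'].
- exact: init_share_sort.
- exact: share_sort.
- exact: (hrep_JMeq (or_intror rs) xx' sN).
Qed.

Definition init_hom : dhom init_model N :=
  @DHom D init_model N init_hom_nom init_hom_at init_hom_share.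

End InitialModel.

Theorem theorem11 (D : signature) (Gamma : sentence D -> Prop) :
  exists M : dmodel D,
    reachable M /\ satisfies M Gamma /\
    forall N : dmodel D, satisfies N Gamma -> exists! h : dhom M N, True.
Proof.
exists (init_model Gamma); split; first exact: init_reachable.
split=> [|N sN]; first exact: init_satisfies.
exists (init_hom sN); split=> // h _.
exact: reachable_hom_unique (init_reachable Gamma).
Qed.
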